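(* Let $G$ be a finite, connected, simple graph of order $n\ge 2$. Then $\phi(G)\le \Psi(G)\le \beta(G)+\phi(G)$.
   Context: $d_G$ denotes graph distance. A set $S\subseteq V(G)$ is resolving if for all distinct $u,v$ some $y\in S$ has $d_G(u,y)\neq d_G(v,y)$; $\beta(G)$ (the metric dimension) is the minimum size of a resolving set. A pair $\{x,y\}$ doubly resolves $\{u,v\}$ if $d_G(u,x)-d_G(u,y)\neq d_G(v,x)-d_G(v,y)$; $S$ is a doubly resolving set if every pair of distinct vertices is doubly resolved by some pair of vertices of $S$, and $\Psi(G)$ is the minimum size of a doubly resolving set. For a vertex $x$, $T\subseteq V(G)$ is a doubly distance resolving set of $G$ on $x$ if every pair $\{u,v\}$ with $d_G(u,x)\neq d_G(v,x)$ is doubly resolved by some pair of vertices of $T\cup\{x\}$; $\phi(G,x)$ is the minimum size of such a set, and $\phi(G)=\max\{\phi(G,x):x\in V(G)\}$. *)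

(* Defs.v *)
From mathcomp Require Import all_boot all_order all_algebra.

Set Implicit Arguments.
Unset Strict Implicit.
Unset Printing Implicit Defensive.

Import GRing.Theory Num.Theory.

Section Metric.

(* A simple graph is its adjacency relation, symmetric and irreflexive; these
   properties are hypotheses of the statements, not of the definitions. *)
Variables (T : finType) (e : rel T).

Definition connected_graph : Prop := forall x y : T, connect e x y.

Definition has_walk (x y : T) (k : nat) : bool :=
  [exists p : k.-tuple T, path e x p && (last x p == y)].

(* The least k < #|T| such that has_walk x y k. Vertices joined by a walk are
   joined by one of length < #|T| (see gdist_min and gdist_walk); vertices not
   joined by any walk get the junk value #|T|. *)
Definition gdist (x y : T) : nat :=
  find (has_walk x y) (iota 0 #|T|).

Definition resolving (S : {set T}) : bool :=
  [forall u, forall v, (u != v) ==>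
     [exists y in S, gdist u y != gdist v y]].

Definition doubly_resolves (x y u v : T) : bool :=
  ((gdist u x)%:Z - (gdist u y)%:Z != (gdist v x)%:Z - (gdist v y)%:Z)%R.

Definition doubly_resolving (S : {set T}) : bool :=
  [forall u, forall v, (u != v) ==>
     [exists x in S, exists y in S, doubly_resolves x y u v]].

Definition doubly_distance_resolving (x : T) (S : {set T}) : bool :=
  [forall u, forall v, (gdist u x != gdist v x) ==>
     [exists a in x |: S, exists b in x |: S, doubly_resolves a b u v]].

(* The least cardinal of a set satisfying P, provided P holds of [set: T];
   see resolvingT, doubly_resolvingT and doubly_distance_resolvingT. *)
Definition min_card (P : pred {set T}) : nat :=
  #|[arg min_(S < [set: T] | P S) #|S| ]|.

Definition metric_dim : nat := min_card resolving.

Definition Psi : nat := min_card doubly_resolving.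

Definition phi_at (x : T) : nat := min_card (doubly_distance_resolving x).

Definition phi : nat := \max_(x : T) phi_at x.

Lemma has_walkP (x y : T) (k : nat) :
  reflect (exists p, [/\ size p = k, path e x p & last x p = y])
          (has_walk x y k).
Proof.
apply: (iffP existsP) => [[p /andP[ep /eqP lp]]|[p [sp ep lp]]].
  by exists p; split => //; rewrite size_tuple.
have sp' : size p == k by apply/eqP.
by exists (Tuple sp'); rewrite /= ep lp eqxx.
Qed.

Lemma gdist_min (x y : T) (p : seq T) :
  path e x p -> last x p = y -> gdist x y <= size p.
Proof.
move=> ep <-; case/shortenP: ep => q eq uq sub.
have szq : size q < #|T|.
  by rewrite -[_.+1]/(size (x :: q)) -(card_uniqP uq) max_card.
have le_qp : size q <= size p.
  by apply: uniq_leq_size sub; case/andP: uq.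
apply: leq_trans le_qp.
rewrite leqNgt; apply/negP => lt; move: (before_find 0 lt).
by rewrite nth_iota // add0n => /negbT/negP[]; apply/has_walkP; exists q.
Qed.

Lemma gdist_walk (x y : T) : connect e x y -> has_walk x y (gdist x y).
Proof.
case/connectP => p ep ly; case/shortenP: ep ly => q eq uq _ ->.
have szq : size q < #|T|.
  by rewrite -[_.+1]/(size (x :: q)) -(card_uniqP uq) max_card.
have lt : gdist x (last x q) < #|T| by apply: leq_ltn_trans szq; exact: gdist_min.
have: has (has_walk x (last x q)) (iota 0 #|T|).
  by rewrite has_find size_iota.
by move/(nth_find 0); rewrite nth_iota.
Qed.

Lemma gdist0 (x : T) : gdist x x = 0.
Proof. by apply/eqP; rewrite -leqn0 (@gdist_min x x [::]). Qed.

Lemma gdist_eq0 (x y : T) : connect e x y -> (gdist x y == 0) = (x == y).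
Proof.
move=> cxy; apply/eqP/eqP => [d0|<-]; last exact: gdist0.
by move: (gdist_walk cxy); rewrite d0 => /has_walkP[p [/size0nil -> _]].
Qed.

Lemma resolvingT : connected_graph -> resolving [set: T].
Proof.
move=> conn; apply/forallP => u; apply/forallP => v; apply/implyP => uv.
apply/exists_inP; exists u; rewrite ?inE // gdist0 eq_sym gdist_eq0 //.
by rewrite eq_sym.
Qed.

Lemma doubly_resolvesT (u v : T) :
  connected_graph -> u != v -> doubly_resolves u v u v.
Proof.
move=> conn uv; rewrite /doubly_resolves !gdist0 sub0r subr0.
have: gdist u v != 0 by rewrite gdist_eq0.
by case: (gdist u v).
Qed.

Lemma doubly_resolvingT : connected_graph -> doubly_resolving [set: T].
Proof.
move=> conn; apply/forallP => u; apply/forallP => v; apply/implyP => uv.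
apply/exists_inP; exists u; rewrite ?inE //.
by apply/exists_inP; exists v; rewrite ?inE // doubly_resolvesT.
Qed.

Lemma doubly_distance_resolvingT (x : T) :
  connected_graph -> doubly_distance_resolving x [set: T].
Proof.
move=> conn; apply/forallP => u; apply/forallP => v; apply/implyP => duv.
have uv : u != v by apply: contraNneq duv => ->.
apply/exists_inP; exists u; rewrite ?inE ?orbT //.
by apply/exists_inP; exists v; rewrite ?inE ?orbT // doubly_resolvesT.
Qed.

End Metric.

(* Main.v *)
Require Import Defs.
From mathcomp Require Import all_boot all_order all_algebra.

(** A doubly resolving set is doubly distance resolving on every vertex, whence
    the lower bound. For the upper bound, let [S] be a minimum resolving set,
    [x] a vertex of [S] and [A] a minimum doubly distance resolving set on [x].
    Vertices at different distances from [x] are doubly resolved by a pair of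
    [x |: A]; vertices at the same distance from [x] are separated by some [y]
    in [S], and are then doubly resolved by [x] and [y]. So [S :|: A] is doubly
    resolving. *)

Lemma min_card_le (T : finType) (P : pred {set T}) (S : {set T}) :
  P setT -> P S -> min_card P <= #|S|.
Proof. by move=> PT PS; rewrite /min_card; case: arg_minnP => // A _; apply. Qed.

Lemma min_card_witness (T : finType) (P : pred {set T}) :
  P setT -> exists2 S, P S & #|S| = min_card P.
Proof.
by move=> PT; rewrite /min_card; case: arg_minnP => // S PS _; exists S.
Qed.

Section DoublyResolving.

Variables (T : finType) (e : rel T).

Lemma doubly_resolving_distance (x : T) (S : {set T}) :
  doubly_resolving e S -> doubly_distance_resolving e x S.
Proof.
move=> /forallP drS; apply/forallP => u; apply/forallP => v.
apply/implyP => duv; have uv : u != v by apply: contraNneq duv => ->.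
move/forallP/(_ v)/implyP/(_ uv): (drS u) => /exists_inP[a aS].
move=> /exists_inP[b bS ab]; apply/exists_inP; exists a; first exact: setU1r.
by apply/exists_inP; exists b; first exact: setU1r.
Qed.

(** Some vertex of [S] must separate two distinct vertices; this supplies the base vertex [x] of the
    upper bound. *)
Lemma resolving_neq0 (S : {set T}) : 1 < #|T| -> resolving e S -> S != set0.
Proof.
move=> /card_gt1P[u [v [_ _ uv]]] /forallP/(_ u)/forallP/(_ v)/implyP/(_ uv).
by move=> /exists_inP[y yS _]; apply/set0Pn; exists y.
Qed.

Lemma doubly_resolvingU (x : T) (S A : {set T}) :
  x \in S -> resolving e S -> doubly_distance_resolving e x A ->
  doubly_resolving e (S :|: A).
Proof.
move=> xS /forallP rS /forallP dA.
apply/forallP => u; apply/forallP => v; apply/implyP => uv.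
have [duv|duv] := eqVneq (gdist e u x) (gdist e v x).
  move/forallP/(_ v)/implyP/(_ uv): (rS u) => /exists_inP[y yS yuv].
  apply/exists_inP; exists x; first by rewrite inE xS.
  apply/exists_inP; exists y; first by rewrite inE yS.
  (* By [duv] the distances to [x] cancel, so equal differences would force equal distances to
     [y]. *)
  apply: contraNneq yuv; rewrite duv => /GRing.addrI/GRing.oppr_inj[->].
  exact: eqxx.
(* Since [x] is taken inside [S], adjoining it to [A] costs no extra vertex in the bound. *)
have subA : {subset x |: A <= S :|: A}.
  by apply/subsetP; rewrite setSU ?sub1set.
move/forallP/(_ v)/implyP/(_ duv): (dA u) => /exists_inP[a /subA aA].
move=> /exists_inP[b /subA bA ab]; apply/exists_inP; exists a => //.
by apply/exists_inP; exists b.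
Qed.

End DoublyResolving.

Theorem theorem6 (T : finType) (e : rel T)
  (e_sym : symmetric e) (e_irr : irreflexive e)
  (e_conn : connected_graph e) (card_T : 2 <= #|T|) :
  phi e <= Psi e /\ Psi e <= metric_dim e + phi e.
Proof.
have drT := doubly_resolvingT e_conn.
have ddT x := doubly_distance_resolvingT x e_conn.
split.
  apply/bigmax_leqP => x _; rewrite /Psi.
  have [S drS <-] := min_card_witness _ _ drT.
  by apply: min_card_le => //; apply: doubly_resolving_distance.
have [S rS cS] := min_card_witness _ _ (resolvingT e_conn).
have /set0Pn[x xS] := resolving_neq0 _ _ _ card_T rS.
have [A dA cA] := min_card_witness _ _ (ddT x).
have drSA := doubly_resolvingU _ _ _ _ _ xS rS dA.
apply: leq_trans (min_card_le _ _ _ drT drSA) _.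
apply: leq_trans (leq_card_setU S A) _.
rewrite /metric_dim -cS leq_add2l cA.
exact: (leq_bigmax (F := phi_at e)).
Qed.
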